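(* Let $\omega$ be a non-principal ultrafilter on $\mathbb N$, let $(X,d)$ be a complete separable metric space, and let $(\mu_i)_{i\in\mathbb N}$ be a sequence of (nonnegative) Borel measures on $X$ such that $\lambda:=\lim_{i\to\omega}\mu_i(X)<+\infty$. Then the following conditions are equivalent: i) Given any $\varepsilon>0$, there exists an $\varepsilon$-totally bounded Borel subset $T$ of $X$ such that $\lim_{i\to\omega}\mu_i(X\setminus T)\le\varepsilon$. ii) The ultralimit $\mu:=\lim_{i\to\omega}\mu_i$ exists with respect to weak convergence in duality with $C_b(X)$.
   Context: $C_b(X)$ is the set of bounded continuous functions $X\to\mathbb R$. A subset $T\subset X$ is $\varepsilon$-totally bounded if it is contained in the union of finitely many balls of radius $\varepsilon$. The weak topology on finite nonnegative Borel measures is the coarsest one making $\mu\mapsto\int f\,d\mu$ continuous for every $f\in C_b(X)$. Condition ii) means that there is a finite nonnegative Borel measure $\mu$ such that for every weak neighbourhood $U$ of $\mu$ one has $\{i:\mu_i(X)<+\infty,\ \mu_i\in U\}\in\omega$. For $[0,+\infty]$-valued sequences, $\lim_{i\to\omega}$ is the usual limit along $\omega$. *)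

(* Defs.v *)
From HB Require Import structures.
From mathcomp Require Import all_boot all_order all_algebra.
From mathcomp Require Import all_classical all_reals all_analysis.

Set Implicit Arguments.
Unset Strict Implicit.
Unset Printing Implicit Defensive.

Import Order.TTheory GRing.Theory Num.Theory.
Import numFieldNormedType.Exports.

Local Open Scope classical_set_scope.
Local Open Scope ring_scope.

(* Complete is a pointed structure, as is measurableType below: the spaces
   considered here are nonempty. *)
#[short(type="completeMetricType")]
HB.structure Definition CompleteMetric (R : numDomainType) :=
  {X of Complete X & Metric R X}.

Definition separable (X : topologicalType) :=
  exists2 D : set X, countable D & dense D.

(* In a metricType, ball x e is the open ball [set y | mdist x y < e]. *)
Definition eps_totally_bounded (R : numDomainType) (X : metricType R)
    (eps : R) (T : set X) :=
  exists2 C : set X, finite_set C & T `<=` \bigcup_(x in C) ball x eps.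

Definition borelType (X : ptopologicalType) := g_sigma_algebraType (@open X).

HB.instance Definition _ (X : ptopologicalType) :=
  Measurable.copy (borelType X) (g_sigma_algebraType (@open X)).

Definition Cb (R : realType) (X : topologicalType) : set (X -> R) :=
  [set f | continuous f /\ bounded_fun f].

Section finite_borel_measures.
Variables (R : realType) (X : ptopologicalType).

Definition fin_borel_measure := {finite_measure set (borelType X) -> \bar R}.

HB.instance Definition _ := gen_eqMixin fin_borel_measure.
HB.instance Definition _ := gen_choiceMixin fin_borel_measure.

Definition integral_of (f : X -> R) (m : fin_borel_measure) : R :=
  \int[m]_(x in [set: borelType X]) f x.

(* The coarsest topology making integral_of f continuous for all f in C_b(X):
   the supremum of the initial topologies of these maps. *)
Definition weak_measures := sup_topology (fun f : @Cb R X =>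
  Topological.class (initial_topology (integral_of (\val f)))).

HB.instance Definition _ := Topological.on weak_measures.

End finite_borel_measures.

Section measure_to_finite.
Variables (R : realType) (X : ptopologicalType).
Variables (nu : {measure set (borelType X) -> \bar R})
  (nu_fin : (nu [set: borelType X] < +oo)%E).

(* The unused hypothesis is what the finite measure instance below is built
   from. *)
Definition finite_copy of (nu [set: borelType X] < +oo)%E :
  set (borelType X) -> \bar R := nu.

Let m := finite_copy nu_fin.

Let m0 : m set0 = 0%E. Proof. exact: measure0. Qed.
Let m_ge0 A : (0 <= m A)%E. Proof. exact: measure_ge0. Qed.
Let m_sigma : semi_sigma_additive m.
Proof. exact: measure_semi_sigma_additive. Qed.
HB.instance Definition _ := isMeasure.Build _ _ _ m m0 m_ge0 m_sigma.

Let m_fin : fin_num_fun m.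
Proof.
move=> A mA; rewrite ge0_fin_numE//; apply: le_lt_trans nu_fin.
by apply: le_measure; rewrite ?inE.
Qed.
HB.instance Definition _ := Measure_isFinite.Build _ _ _ m m_fin.

Definition to_finite : weak_measures R X := (m : fin_borel_measure R X).

End measure_to_finite.

Definition weak_ultralimit (R : realType) (X : ptopologicalType)
    (omega : set_system nat) (mu : nat -> {measure set (borelType X) -> \bar R})
    (m : weak_measures R X) :=
  forall U : set (weak_measures R X), nbhs m U ->
    omega [set i | exists mui_fin : (mu i [set: borelType X] < +oo)%E,
                     U (to_finite mui_fin)].

(* Main.v *)
Require Import Defs.
From HB Require Import structures.
From mathcomp Require Import all_boot all_order all_algebra.
From mathcomp Require Import finmap measurable_realfun lra.
From mathcomp Require Import all_classical all_reals all_analysis.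

Set Implicit Arguments.
Unset Strict Implicit.
Unset Printing Implicit Defensive.

Import Order.TTheory GRing.Theory Num.Theory.
Import numFieldNormedType.Exports.

Local Open Scope classical_set_scope.
Local Open Scope ring_scope.

(** The masses are eventually bounded, so [beta A := lim mu_i A] along [omega]
    exists for every Borel set [A] and is a finitely additive set function.
    Under i), [beta (C n)] tends to [0] for closed sets [C n] decreasing to the
    empty set: otherwise [C n] meets the first [n] totally bounded sets for
    every [n], and points chosen there form a Cauchy sequence along [omega],
    whose limit lies in every [C n].  This smoothness makes
    [A |-> inf {sup {beta C | C closed, C <= U} | U open, A <= U}]
    an outer measure for which open sets are Caratheodory measurable.  It
    induces a Borel measure [m] with [m X = beta X] and [m U <= beta U] for [U]
    open, which yields weak convergence by slicing bounded continuous functions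
    into superlevel sets.
    Conversely, if the weak ultralimit [m] exists, then [m] is almost carried by
    finitely many balls of radius [eps / 2], and a continuous function that is
    [0] there and [1] off the concentric balls of radius [eps] transfers this
    to the [mu_i]. *)

(** * Regularization of a finitely additive set function *)

(** [K n] removes the interiors of all balls of radius [1 / (n + 1)] centred outside [U]. Interiors
    are taken because balls of a pseudometric structure need not be open. *)
Lemma open_closed_exhaustion (R : realType) (X : pseudoMetricType R)
    (U : set X) : open U ->
  exists K : nat -> set X,
    [/\ forall n, closed (K n), forall n, K n `<=` K n.+1,
        forall n, K n `<=` U & U `<=` \bigcup_n (K n)°].
Proof.
move=> oU; pose r n : R := n.+1%:R^-1.
have r_gt0 n : 0 < r n by rewrite invr_gt0.
exists (fun n => ~` \bigcup_(y in ~` U) (ball y (r n))°); split=> [n|n|n|].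
- by apply: open_closedC; apply: bigcup_open => y _; exact: open_interior.
- apply: subsetC => z [y Uy yz]; exists y => //.
  apply: interiorS yz; apply: le_ball.
  by rewrite lef_pV2 ?posrE// ler_nat.
- move=> z /= Kz; apply: contrapT => Uz; apply: Kz; exists z => //.
  by apply: nbhsx_ballx; exact: r_gt0.
- move=> x Ux; have /nbhs_ballP[e /= e0 eU] : nbhs x U by exact: open_nbhs_nbhs.
  (* With [r n < e / 2], a ball of radius [r n] about [y] outside [U] cannot meet [ball x (r n)]:
     otherwise [y] would lie in [ball x e], hence in [U]. *)
  have [n _ /(_ n (leqnn n)) ne] :=
    near_infty_natSinv_lt (PosNum (divr_gt0 e0 (@ltr0n R 2))).
  exists n => //; apply/nbhs_ballP; exists (r n); first exact: r_gt0.
  move=> z xz [y Uy] /interior_subset.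
  move=> /ball_sym zy; apply: Uy; apply: eU.
  by apply: le_ball (ball_triangle xz zy); rewrite [e]splitr lerD// ltW.
Qed.

Lemma borel_open (X : ptopologicalType) (U : set X) :
  open U -> measurable (U : set (borelType X)).
Proof. by move=> oU; exact: sub_gen_smallest. Qed.

Lemma borel_closed (X : ptopologicalType) (C : set X) :
  closed C -> measurable (C : set (borelType X)).
Proof.
by move=> cC; rewrite -[C]setCK; apply: measurableC; apply: borel_open;
  exact: closed_openC.
Qed.

Section content_regularization.
Variables (R : realType) (X : pseudoPMetricType R).
Variable beta : set (borelType X) -> R.
Hypothesis beta_ge0 : forall A, measurable A -> 0 <= beta A.
Hypothesis betaU : forall A B, measurable A -> measurable B ->
  [disjoint A & B] -> beta (A `|` B) = beta A + beta B.
Hypothesis beta_closed_cvg0 : forall C : nat -> set X,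
  (forall n, closed (C n)) -> (forall n, C n.+1 `<=` C n) ->
  \bigcap_n C n = set0 ->
  forall e, 0 < e -> exists n, beta (C n) < e.

Lemma additive_set0 : beta set0 = 0.
Proof.
have := betaU measurable0 measurable0 (introT eqP (set0I _)).
by rewrite setU0 => /eqP; rewrite -subr_eq subrr eq_sym => /eqP.
Qed.

Lemma additive_le A B : measurable A -> measurable B -> A `<=` B ->
  beta A <= beta B.
Proof.
move=> mA mB AB; rewrite -(setDUK AB) betaU//; last 2 first.
- exact: measurableD.
- by apply/eqP; rewrite setDE setICA setICr setI0.
by rewrite lerDl beta_ge0//; exact: measurableD.
Qed.

Lemma additive_leU A B : measurable A -> measurable B ->
  beta (A `|` B) <= beta A + beta B.
Proof.
move=> mA mB; have mBA : measurable (B `\` A) by exact: measurableD.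
have -> : A `|` B = A `|` (B `\` A) by rewrite setDE setUIr setUCr setIT.
rewrite betaU//; last by apply/eqP; rewrite setDE setICA setICr setI0.
by rewrite lerD2l additive_le.
Qed.

Lemma additive_le_bigU (A : nat -> set (borelType X)) n :
  (forall k, measurable (A k)) ->
  beta (\big[setU/set0]_(k < n) A k) <= \sum_(k < n) beta (A k).
Proof.
move=> mA; elim: n => [|n ih]; first by rewrite !big_ord0 additive_set0.
rewrite !big_ord_recr/=; apply: le_trans (additive_leU _ _) _ => //.
  exact: bigsetU_measurable.
by rewrite lerD2r.
Qed.

Local Open Scope ereal_scope.

Definition inner_content (U : set X) : \bar R :=
  ereal_sup [set (beta C)%:E | C in [set C : set X | closed C /\ C `<=` U]].

Definition outer_content (A : set X) : \bar R :=
  ereal_inf [set inner_content U | U in [set U : set X | open U /\ A `<=` U]].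

Lemma inner_content_ge U C : closed C -> C `<=` U ->
  (beta C)%:E <= inner_content U.
Proof. by move=> cC CU; apply: ereal_sup_ubound; exists C. Qed.

Lemma inner_content_le U V : U `<=` V -> inner_content U <= inner_content V.
Proof.
move=> UV; apply: ge_ereal_sup => _ [C [cC CU] <-].
by apply: inner_content_ge => //; exact: subset_trans UV.
Qed.

Lemma inner_content_ge0 U : 0 <= inner_content U.
Proof.
by have := inner_content_ge closed0 (@sub0set _ U); rewrite additive_set0.
Qed.

Lemma inner_content_le_val U : measurable (U : set (borelType X)) ->
  inner_content U <= (beta U)%:E.
Proof.
move=> mU; apply: ge_ereal_sup => _ [C [cC CU] <-].
by rewrite lee_fin additive_le//; exact: borel_closed.
Qed.

Lemma inner_content_setT : inner_content setT = (beta setT)%:E.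
Proof.
apply/eqP; rewrite eq_le inner_content_le_val//=.
exact: inner_content_ge closedT _.
Qed.

Lemma outer_content_open U : open U -> outer_content U = inner_content U.
Proof.
move=> oU; apply/eqP; rewrite eq_le; apply/andP; split.
  by apply: ereal_inf_lbound; exists U => //; split.
by apply: le_ereal_inf_tmp => _ [V [oV UV] <-]; exact: inner_content_le.
Qed.

Lemma outer_content0 : outer_content set0 = 0.
Proof.
apply/eqP; rewrite outer_content_open; last exact: open0.
rewrite eq_le inner_content_ge0 andbT.
by have := inner_content_le_val measurable0; rewrite additive_set0.
Qed.

Lemma outer_content_ge0 A : 0 <= outer_content A.
Proof.
by apply: le_ereal_inf_tmp => _ [V [oV AV] <-]; exact: inner_content_ge0.
Qed.

Lemma outer_content_le : {homo outer_content : A B / A `<=` B >-> A <= B}.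
Proof.
move=> A B AB; apply: ereal_inf_le_tmp => _ [U [oU BU] <-].
by exists U => //; split => //; exact: subset_trans BU.
Qed.

Lemma outer_content_fin_num A : outer_content A \is a fin_num.
Proof.
rewrite ge0_fin_numE ?outer_content_ge0//.
apply: le_lt_trans (outer_content_le (@subsetT _ A)) _.
by rewrite outer_content_open ?inner_content_setT ?ltry//; exact: openT.
Qed.

(** Smoothness of [beta] enters here. A closed [C] inside the union is covered by stage [n] of the
    closed exhaustions of the first [n] sets, up to a closed remainder [D n]. These remainders
    decrease to the empty set, so finite subadditivity suffices up to [e]. *)
Lemma inner_content_bigcup (U : nat -> set X) : (forall n, open (U n)) ->
  inner_content (\bigcup_n U n) <= \sum_(n <oo) inner_content (U n).
Proof.
move=> oU; apply: ge_ereal_sup => _ [C [cC CU] <-].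
apply/lee_addgt0Pr => e e0.
have /choice[K] := fun n => open_closed_exhaustion (oU n).
move=> /all_and4[cK ndK KU UK].
pose D n := C `\` \bigcup_(k < n) (K k n)°.
have KS k n m : (n <= m)%N -> K k n `<=` K k m.
  move=> /subnK <-; elim: (m - n)%N => // j ih.
  by apply: subset_trans ih _; exact: ndK.
have cD n : closed (D n).
  apply: closedI => //; apply: open_closedC; apply: bigcup_open => k _.
  exact: open_interior.
have DS n : D n.+1 `<=` D n.
  apply: setDS => x [k /= kn Kx]; exists k; first exact: ltnW.
  by apply: interiorS Kx; exact: ndK.
have D0 : \bigcap_n D n = set0.
  rewrite -subset0 => x Dx; have [Cx _] := Dx 0%N I.
  have [k _ /UK[m _ Kx]] := CU x Cx.
  (* The index exceeds [k], so that [U k] is among the sets used, and is at least [m], so that its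
     exhaustion has already reached [x]. *)
  have [_] := Dx (maxn k.+1 m) I; apply; exists k; first by rewrite /= leq_maxl.
  by apply: interiorS Kx; apply: KS; exact: leq_maxr.
have [n Dn] := beta_closed_cvg0 cD DS D0 e0.
have mK k m := borel_closed (cK k m).
apply: (@le_trans _ _ (\sum_(k < n) inner_content (U k) + e%:E)); last first.
  rewrite leeD2r// -(big_mkord xpredT (fun k => inner_content (U k))).
  by apply: nneseries_lim_ge => k _ _; exact: inner_content_ge0.
apply: (@le_trans _ _ (\sum_(k < n) (beta (K k n))%:E + e%:E)); last first.
  by rewrite leeD2r//; apply: lee_sum => k _; exact: inner_content_ge.
have mKn : measurable (\big[setU/set0]_(k < n) (K k n : set (borelType X))).
  by apply: bigsetU_measurable => k _; exact: mK.
rewrite sumEFin -EFinD lee_fin.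
apply: (@le_trans _ _ (beta (\big[setU/set0]_(k < n) K k n `|` D n))).
  apply: additive_le; first exact: borel_closed.
    exact: measurableU mKn (borel_closed (cD n)).
  move=> x Cx; have [Kx|Kx] := pselect ((\bigcup_(k < n) (K k n)°) x);
    [left|by right].
  case: Kx => k kn /interior_subset Kx.
  by rewrite -(bigcup_mkord n (fun k => K k n)); exists k.
apply: le_trans (additive_leU mKn (borel_closed (cD n))) _.
rewrite lerD ?(ltW Dn)//.
by apply: (additive_le_bigU (A := fun k => K k n)) => k; exact: mK.
Qed.

Lemma outer_content_sigma_subadditive : sigma_subadditive outer_content.
Proof.
move=> A; apply/lee_addgt0Pr => e e0.
apply: le_trans (epsilon_trick _ _ (ltW e0)); last first.
  by move=> n; exact: outer_content_ge0.
have en n : (0 < e / (2 ^ n.+1)%:R)%R by rewrite divr_gt0// ltr0n expn_gt0.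
have /choice[U hU] n : exists U : set X, [/\ open U, A n `<=` U &
    inner_content U <= outer_content (A n) + (e / (2 ^ n.+1)%:R)%:E].
  have [_ [U [oU AU] <-] /ltW UA] :=
    lb_ereal_inf_adherent (en n) (outer_content_fin_num (A n)).
  by exists U.
have {hU} [oU AU UA] := all_and3 hU.
apply: (@le_trans _ _ (\sum_(n <oo) inner_content (U n))).
  apply: le_trans (inner_content_bigcup oU).
  apply: ereal_inf_lbound; exists (\bigcup_n U n) => //; split.
    exact: bigcup_open.
  exact: subset_bigcup.
apply: lee_nneseries => [n _ _|n _]; first exact: inner_content_ge0.
exact: UA.
Qed.

HB.instance Definition _ := isOuterMeasure.Build R X outer_content
  outer_content0 outer_content_ge0 outer_content_le
  outer_content_sigma_subadditive.

(** Let [W] be open around [A]. Any closed [C] in [W] and [U], and then any closed [D] in [W] minus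
    [C], are disjoint inside [W], so [beta C + beta D] is at most the inner content of [W]. The
    suprema over [D] and then over [C] bound the contents of [A] outside and inside [U]. *)
Lemma open_caratheodory U : open U -> outer_content.-caratheodory U.
Proof.
move=> oU; apply: le_caratheodory_measurable => A.
apply: le_ereal_inf_tmp => _ [W [oW AW] <-].
rewrite -leeBrDr ?outer_content_fin_num//.
apply: (@le_trans _ _ (inner_content (W `&` U))).
  rewrite -outer_content_open; last exact: openI.
  by apply: outer_content_le; exact: setSI.
apply: ge_ereal_sup => _ [C [cC CWU] <-].
rewrite leeBrDr ?outer_content_fin_num// -leeBrDl//.
have oWC : open (W `\` C) by apply: openI => //; exact: closed_openC.
apply: (@le_trans _ _ (inner_content (W `\` C))).
  rewrite -outer_content_open//; apply: outer_content_le => x [Ax Ux].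
  by split; [exact: AW|move=> /CWU[]].
apply: ge_ereal_sup => _ [D [cD DWC] <-].
rewrite leeBrDl// -EFinD -betaU; last 3 first.
- exact: borel_closed.
- exact: borel_closed.
- by apply/eqP; rewrite -subset0 => x [Cx /DWC[]].
apply: inner_content_ge; first exact: closedU.
by move=> x [/CWU[]//|/DWC[]].
Qed.

Lemma borel_caratheodory (A : set (borelType X)) : measurable A ->
  outer_content.-caratheodory A.
Proof.
move: A; apply: smallest_sub; last by move=> U; exact: open_caratheodory.
split.
- exact: caratheodory_measurable_set0.
- by move=> A mA; rewrite setTD; exact: caratheodory_measurable_setC.
- by move=> F mF; exact: caratheodory_measurable_bigcup.
Qed.

(** A separate name over [borelType X], to carry the measure structure for the Borel sigma-algebra
    next to the outer measure structure of [outer_content]. *)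
Definition regularization : set (borelType X) -> \bar R := outer_content.

Let regularization_sigma_additive : semi_sigma_additive regularization.
Proof.
move=> F mF tF mUF.
apply: (@caratheodory_measure_sigma_additive R X outer_content) => //.
- by move=> n; exact: borel_caratheodory.
- exact: borel_caratheodory.
Qed.

HB.instance Definition _ := isMeasure.Build _ (borelType X) R regularization
  outer_content0 outer_content_ge0 regularization_sigma_additive.

Let regularization_fin : fin_num_fun regularization.
Proof. by move=> A _; exact: outer_content_fin_num. Qed.

HB.instance Definition _ :=
  Measure_isFinite.Build _ _ _ regularization regularization_fin.

Lemma content_regularization : exists m : fin_borel_measure R X,
  m setT = (beta setT)%:E /\ forall U : set X, open U -> m U <= (beta U)%:E.
Proof.
exists (regularization : fin_borel_measure R X); split=> [|U oU] /=.
  rewrite /regularization outer_content_open ?inner_content_setT//.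
  exact: openT.
rewrite /regularization outer_content_open//; apply: inner_content_le_val.
exact: borel_open.
Qed.

End content_regularization.

(** * Ultrafilters *)

Lemma fmap_ultra (T U : Type) (f : T -> U) (F : set_system T) :
  UltraFilter F -> UltraFilter (f @ F).
Proof.
move=> FU; split=> [|G GF sFG]; first exact: fmap_proper_filter.
apply/seteqP; split=> [A GA|]; last exact: sFG.
have [//|FnA] := in_ultra_setVsetC (f @^-1` A) FU.
have GnA : G (~` A) by apply: sFG; rewrite /fmap/= preimage_setC.
by have [x []] := filter_ex (filterI GA GnA).
Qed.

Lemma ultra_finite_bigcup (T : Type) (I : choiceType) (F : set_system T)
    (D : set I) (A : I -> set T) : UltraFilter F -> finite_set D ->
  F (\bigcup_(i in D) A i) -> exists2 i, D i & F (A i).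
Proof.
move=> FU /finite_fsetP[E ->] FA; apply: contrapT => nA.
have FnA : F (\bigcap_(i in [set` E]) ~` A i).
  apply: filter_bigI => i iE; have [FAi|//] := in_ultra_setVsetC (A i) FU.
  by exfalso; apply: nA; exists i.
by have [x [[i iE Aix] /(_ i iE)]] := filter_ex (filterI FA FnA).
Qed.

(** The image ultrafilter contains the compact segment [[-M, M]], hence converges. *)
Lemma ultra_is_cvg_bounded (R : realType) (I : Type) (F : set_system I)
    (u : I -> R) (M : R) : UltraFilter F -> (forall i, `|u i| <= M) ->
  cvg (u @ F).
Proof.
move=> FU uM; have := @segment_compact R (- M) M; rewrite compact_ultra.
case/(_ (u @ F)) => [||l [_ ul]]; first exact: fmap_ultra.
  by apply: nearW => i /=; rewrite in_itv/= -ler_norml.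
by apply/cvg_ex; exists l.
Qed.

(** Otherwise [F] contains a finite set, hence a singleton, and is principal. *)
Lemma nonprincipal_ultra_ge (F : set_system nat) : UltraFilter F ->
  (forall n, F <> principal_filter n) -> forall n, F [set i | (n <= i)%N].
Proof.
move=> FU FP n; have [//|Fn] := in_ultra_setVsetC [set i | (n <= i)%N] FU.
exfalso; have /(ultra_finite_bigcup FU (finite_II n)) :
    F (\bigcup_(k in `I_n) [set k]).
  by apply: filterS Fn => i /= /negP; rewrite -ltnNge => ni; exists i.
case=> k _ Fk; apply: (FP k).
apply: (@max_filter _ _ (principal_filter_ultra k)).
by move=> A /principal_filterP Ak; apply: filterS Fk => _ ->.
Qed.

(* Cantor's intersection theorem, with total boundedness in place of
   vanishing diameters. *)
Lemma closed_totally_bounded_inter (R : realType) (X : completeMetricType R)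
    (omega : set_system nat) (C T : nat -> set X) (eps : nat -> R) :
  UltraFilter omega -> (forall n, omega <> principal_filter n) ->
  (forall n, closed (C n)) -> (forall n, C n.+1 `<=` C n) ->
  (forall n, eps_totally_bounded (eps n) (T n)) ->
  (forall e, 0 < e -> exists n, eps n <= e) ->
  (forall n, (C n `&` \bigcap_(k < n) T k) !=set0) ->
  (\bigcap_n C n) !=set0.
Proof.
move=> oU onp cC dC tbT eps0 /choice[x xCT].
have CS n m : (n <= m)%N -> C m `<=` C n.
  move=> /subnK <-; elim: (m - n)%N => // j ih.
  exact: subset_trans (dC _) ih.
have xU := fmap_ultra x oU.
have oge := nonprincipal_ultra_ge oU onp.
have /cauchy_cvg : cauchy (x @ omega).
  (* From index [n + 1] on, [x i] lies in [T n], which finitely many balls of radius at most [e]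
     cover; the ultrafilter selects one of them. *)
  apply: cauchy_exP => e /eps0[n ne]; have [D fD TD] := tbT n.
  have [y _ xy] : exists2 y, D y & (x @ omega) (ball y (eps n)).
    apply: ultra_finite_bigcup fD _; rewrite /fmap/=.
    apply: filterS (oge n.+1) => i ni.
    by apply: TD; exact: (xCT i).2 n ni.
  by exists y; apply: filterS xy; exact: le_ball.
move=> /cvg_ex[l xl]; exists l => n _.
apply: closed_cvg (cC n) _ _ xl; apply: filterS (oge n) => i ni.
by apply: CS ni _ _; exact: (xCT i).1.
Qed.

(** * Integrals and superlevel sets *)

Lemma integrable_bounded d (T : measurableType d) (R : realType)
    (m : {finite_measure set T -> \bar R}) (f : T -> R) (B : R) :
  measurable_fun setT f -> (forall x, `|f x| <= B) ->
  m.-integrable setT (EFin \o f).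
Proof.
move=> mf fB; apply: measurable_bounded_integrable => //.
  exact: fin_num_fun_lty.
exists B; split=> [|C /ltW BC x _]; first exact: num_real.
exact: le_trans BC.
Qed.

Lemma bounded_fun_exP (R : realType) (T : Type) (f : T -> R) :
  bounded_fun f <-> exists B, forall x, `|f x| <= B.
Proof.
split=> [[B [Br fB]]|[B fB]].
  by exists (B + 1) => x; apply: (fB (B + 1)) => //; rewrite ltrDl.
exists B; split=> [|C /ltW BC x _]; first exact: num_real.
exact: le_trans BC.
Qed.

Lemma continuous_borel_measurable (R : realType) (X : ptopologicalType)
    (f : X -> R) : continuous f ->
  measurable_fun setT (f : borelType X -> R).
Proof.
move=> /continuousP cf.
apply: (measurability _ (RGenOpens.measurableE R)).
move=> _ [_ [a [b ->] <-]]; rewrite setTI; apply: sub_gen_smallest.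
exact/cf/interval_open.
Qed.

Section layers.
Variable R : realType.
Implicit Types (t e : R) (N : nat).

Lemma sum_layers_full e t N : 0 < e -> N%:R * e < t ->
  \sum_(k < N) (k.+1%:R * e < t)%R%:R = N%:R :> R.
Proof.
move=> e0 Nt; rewrite (eq_bigr (fun=> 1)) => [|k _].
  by rewrite sumr_const card_ord.
suff -> : k.+1%:R * e < t by [].
by apply: le_lt_trans Nt; rewrite ler_pM2r// ler_nat.
Qed.

(** The sum counts the positive multiples of [e] below [t], capped at [N]. At each inductive step
    either all layers are full or the last one is empty. *)
Lemma sum_layers_le e t N : 0 < e -> 0 <= t ->
  e * \sum_(k < N) (k.+1%:R * e < t)%R%:R <= t.
Proof.
move=> e0 t0; elim: N => [|N ih]; first by rewrite big_ord0 mulr0.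
have [Nt|tN] := ltP (N.+1%:R * e) t.
  by rewrite sum_layers_full// mulrC ltW.
by rewrite big_ord_recr/= ltNge tN addr0.
Qed.

Lemma sum_layers_ge e t N : 0 < e -> t <= N.+1%:R * e ->
  t <= e + e * \sum_(k < N) (k.+1%:R * e < t)%R%:R.
Proof.
move=> e0; elim: N => [|N ih] tN.
  by rewrite big_ord0 mulr0 addr0 -[e]mul1r.
have [Nt|{}tN] := ltP (N.+1%:R * e) t.
  by rewrite sum_layers_full// (le_trans tN)// mulrC -natr1 mulrDr mulr1 addrC.
by rewrite big_ord_recr/= [_ < t]ltNge tN addr0 ih.
Qed.

End layers.

Section layer_integral.
Variables (d : measure_display) (T : measurableType d) (R : realType).
Variables (m : {finite_measure set T -> \bar R}) (f : T -> R).
Variables (e : R) (N : nat).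
Hypotheses (mf : measurable_fun setT f) (e0 : 0 < e).
Hypotheses (f_ge0 : forall x, 0 <= f x) (f_le : forall x, f x <= N.+1%:R * e).

Let A k := [set x | k.+1%:R * e < f x].

Lemma measurable_gt (g : T -> R) (c : R) : measurable_fun setT g ->
  measurable [set x | c < g x].
Proof.
move=> mg; rewrite [X in measurable X](_ : _ = setT `&` g @^-1` `]c, +oo[).
  exact: mg.
by rewrite setTI; apply/seteqP; split=> x /=; rewrite in_itv/= andbT.
Qed.

Let mA k : measurable (A k). Proof. exact: measurable_gt. Qed.

(** [e * s] is a step function below [f] that misses it by at most [e]; its integral only involves
    the masses of the superlevel sets [A k]. *)
Let s x := \sum_(k < N) \1_(A k) x : R.

Let sE x : s x = \sum_(k < N) (k.+1%:R * e < f x)%R%:R.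
Proof.
apply: eq_bigr => k _; rewrite indicE; congr (nat_of_bool _)%:R.
by apply/idP/idP; rewrite inE.
Qed.

Let integrable_s : m.-integrable setT (EFin \o s).
Proof.
rewrite (_ : EFin \o s = fun x => \sum_(k < N) (\1_(A k) x)%:E)%E.
  by apply: integrable_sum => // k _; exact: integrable_indic.
by apply/funext => x /=; rewrite sumEFin.
Qed.

Let Rintegral_s : \int[m]_(x in setT) s x = \sum_(k < N) fine (m (A k)).
Proof.
rewrite /Rintegral (eq_integral (fun x => \sum_(k < N) (\1_(A k) x)%:E)%E).
  rewrite ge0_integral_sum//=; last first.
    by move=> k; apply/measurable_EFinP; exact: measurable_indic.
  rewrite sum_fine => [|k _]; last exact: fin_num_measure.
  by congr fine; apply: eq_bigr => k _; rewrite integral_indic// setIT.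
by move=> x _; rewrite sumEFin.
Qed.

Let integrable_f : m.-integrable setT (EFin \o f).
Proof.
apply: (@integrable_bounded _ _ _ m _ (N.+1%:R * e)) => // x.
by rewrite ger0_norm.
Qed.

Lemma Rintegral_ge_layers :
  e * \sum_(k < N) fine (m (A k)) <= \int[m]_(x in setT) f x.
Proof.
rewrite -Rintegral_s -RintegralZl//; apply: le_Rintegral => //.
  exact: (integrableZl measurableT e integrable_s).
by move=> x _; rewrite sE; exact: sum_layers_le.
Qed.

Lemma Rintegral_le_layers : \int[m]_(x in setT) f x <=
  e * fine (m setT) + e * \sum_(k < N) fine (m (A k)).
Proof.
have int_e : m.-integrable setT (EFin \o (fun=> e)).
  by apply: (@integrable_bounded _ _ _ m _ `|e|) => //; exact: measurable_cst.
have int_es : m.-integrable setT (EFin \o (fun x => e * s x)).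
  exact: (integrableZl measurableT e integrable_s).
rewrite -Rintegral_s -RintegralZl// -Rintegral_cst// -RintegralD//.
apply: le_Rintegral => //; first exact: (integrableD measurableT int_e int_es).
by move=> x _; rewrite sE; exact: sum_layers_ge.
Qed.

End layer_integral.

(** * Limits of finite measures along an ultrafilter *)

Section limit_content.
Variables (R : realType) (X : ptopologicalType) (omega : set_system nat).
Variables (nu : nat -> fin_borel_measure R X) (M : R).
Hypotheses (omegaU : UltraFilter omega).
Hypothesis nu_le : forall i, (nu i setT <= M%:E)%E.

(** The [beta] of the overview. On Borel sets the values lie in [[0, M]], so the limit along the
    ultrafilter exists; elsewhere [lim] may return a default value. *)
Definition limit_content (A : set (borelType X)) : R :=
  lim (fine (nu i A) @[i --> omega]).

Lemma fine_mass_le i (A : set (borelType X)) :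
  measurable A -> fine (nu i A) <= M.
Proof.
move=> mA; rewrite -lee_fin fineK ?fin_num_measure//.
by apply: le_trans (nu_le i); apply: le_measure; rewrite ?inE.
Qed.

Lemma cvg_limit_content (A : set (borelType X)) : measurable A ->
  fine (nu i A) @[i --> omega] --> limit_content A.
Proof.
move=> mA; apply: (@ultra_is_cvg_bounded R nat omega _ M) => i.
by rewrite ger0_norm ?fine_ge0// fine_mass_le.
Qed.

Lemma limit_content_ge0 (A : set (borelType X)) : measurable A ->
  0 <= limit_content A.
Proof.
move=> mA; apply: limr_ge; first exact: cvg_limit_content mA.
by apply: nearW => i; exact: fine_ge0.
Qed.

Lemma limit_contentU (A B : set (borelType X)) :
  measurable A -> measurable B -> [disjoint A & B] ->
  limit_content (A `|` B) = limit_content A + limit_content B.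
Proof.
move=> mA mB AB; apply: cvg_lim => //.
rewrite (_ : (fun i => _) =
    (fun i => fine (nu i A)) + (fun i => fine (nu i B))).
  by apply: cvgD; exact: cvg_limit_content.
apply/funext => i; rewrite measureU//; last exact/eqP.
by rewrite fineD ?fin_num_measure.
Qed.

Variable m : fin_borel_measure R X.
Hypothesis m_setT : m setT = (limit_content setT)%:E.
Hypothesis m_open : forall U : set X, open U -> (m U <= (limit_content U)%:E)%E.

Section bounded_continuous.
Variables (f : X -> R) (B : R).
Hypotheses (cf : continuous f) (fB : forall x, `|f x| <= B).

Let mf : measurable_fun setT (f : borelType X -> R).
Proof. exact: continuous_borel_measurable. Qed.

Let B_ge0 : 0 <= B. Proof. exact: le_trans (normr_ge0 _) (fB point). Qed.

Let integrable_f (p : fin_borel_measure R X) : p.-integrable setT (EFin \o f).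
Proof. exact: integrable_bounded mf fB. Qed.

Let integrable_B (p : fin_borel_measure R X) :
  p.-integrable setT (EFin \o (fun=> B)).
Proof.
by apply: (@integrable_bounded _ _ _ p _ `|B|) => //; exact: measurable_cst.
Qed.

Lemma cvg_integral_of :
  integral_of f (nu i) @[i --> omega] -->
  lim (integral_of f (nu i) @[i --> omega]).
Proof.
apply: (@ultra_is_cvg_bounded R nat omega _ (B * M)) => i.
apply: (le_trans (le_normr_Rintegral measurableT (integrable_f (nu i)))).
apply: (@le_trans _ _ (\int[nu i]_(x in setT) B)).
  apply: le_Rintegral => //.
  exact: (integrable_norm (integrable_f (nu i))).
  exact: integrable_B.
by rewrite Rintegral_cst// ler_wpM2l// fine_mass_le.
Qed.

(** The superlevel sets of the nonnegative shift [g = f + B] are open, so [m] gives them at most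
    their limit content. Hence the upper layer bound for [m] is controlled by the limit of the lower
    layer bounds for [nu i]. *)
Lemma integral_of_le_lim :
  integral_of f m <= lim (integral_of f (nu i) @[i --> omega]).
Proof.
set L := lim _; apply/ler_addgt0Pr => e' e'0.
pose b := limit_content setT; have b0 : 0 <= b by exact: limit_content_ge0.
(* The layer error is [e] times the total mass [b], hence at most [e']; adding [1] keeps the
   denominator positive when [b] is [0]. *)
pose e := e' / (b + 1); have e0 : 0 < e by rewrite divr_gt0// ltr_wpDl.
pose g x := f x + B.
have cg : continuous g by move=> x; apply: cvgD; [exact: cf|exact: cvg_cst].
have mg : measurable_fun setT (g : borelType X -> R).
  exact: continuous_borel_measurable.
have g0 x : 0 <= g x.
  by have := fB x; rewrite ler_norml -lerBlDr sub0r => /andP[].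
pose N := Num.bound ((B + B) / e).
have gN x : g x <= N.+1%:R * e.
  apply: (@le_trans _ _ (B + B)).
    by rewrite lerD2r; have := fB x; rewrite ler_norml => /andP[].
  rewrite -ler_pdivrMr//; apply: le_trans (ltW (archi_boundP _)) _.
    by rewrite divr_ge0 ?addr_ge0// ltW.
  by rewrite ler_nat.
have intg (p : fin_borel_measure R X) :
    \int[p]_(x in setT) g x = integral_of f p + B * fine (p setT).
  rewrite -(Rintegral_cst p measurableT).
  by rewrite -(RintegralD measurableT (integrable_f p) (integrable_B p)).
pose A k : set X := [set x | k.+1%:R * e < g x].
have oA k : open (A k).
  rewrite (_ : A k = g @^-1` [set t | k.+1%:R * e < t])//.
  by apply: open_comp => [x _|]; [exact: cg|exact: open_gt].
have mA k := borel_open (oA k).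
have Sle : e * \sum_(k < N) limit_content (A k) <= L + B * b.
  apply: (@ler_cvg_to _ omega _ _ (fun i => e * \sum_(k < N) fine (nu i (A k)))
    (fun i => integral_of f (nu i) + B * fine (nu i setT))).
  - apply: cvgMl_tmp; apply: cvg_big => [|k _]; first exact: add_continuous.
    exact: cvg_limit_content.
  - apply: cvgD; first exact: cvg_integral_of.
    by apply: cvgMl_tmp; exact: cvg_limit_content.
  - apply: nearW => i; rewrite -intg.
    exact: Rintegral_ge_layers mg e0 g0 gN.
have := Rintegral_le_layers m mg e0 g0 gN.
(* As [m] has total mass [b], the shift contributes the same [B * b] on both sides and cancels. *)
rewrite intg m_setT/= -/b => /le_trans => /(_ (e * b + (L + B * b))).
rewrite addrA lerD2r; have eb : e * b <= e'.
  by rewrite /e mulrAC ler_pdivrMr ?ltr_wpDl// ler_wpM2l ?(ltW e'0)// lerDl.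
move=> h; apply: (@le_trans _ _ (e * b + L)); last by rewrite addrC lerD2l.
apply: h; rewrite -addrA lerD2l; apply: le_trans Sle; rewrite ler_pM2l//.
apply: ler_sum => k _; rewrite -lee_fin fineK.
  exact: m_open (oA k).
by rewrite fin_num_measure//; exact: mA.
Qed.

End bounded_continuous.

(** The one-sided bound, applied to [f] and to [- f], gives equality. *)
Lemma cvg_integral_of_limit_content (f : X -> R) : Cb f ->
  integral_of f (nu i) @[i --> omega] --> integral_of f m.
Proof.
case=> cf /bounded_fun_exP[B fB].
have cNf : continuous (fun x => - f x) by move=> x; apply: cvgN; exact: cf.
have NfB x : `|- f x| <= B by rewrite normrN.
have NE (p : fin_borel_measure R X) :
    integral_of (fun x => - f x) p = - integral_of f p.
  have intf : p.-integrable setT (EFin \o (f : borelType X -> R)).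
    exact: integrable_bounded (continuous_borel_measurable cf) fB.
  rewrite /integral_of -mulN1r -(RintegralZl _ measurableT intf).
  by apply: eq_Rintegral => x _; rewrite mulN1r.
have := cvg_integral_of cf fB; set L := lim _ => fL.
suff -> : integral_of f m = L by [].
apply/eqP; rewrite eq_le (integral_of_le_lim cf fB)/=.
have := integral_of_le_lim cNf NfB; rewrite NE.
rewrite [X in _ <= X](_ : _ = - L) ?lerN2//.
apply: cvg_lim => //; under eq_fun do rewrite NE.
exact: cvgN.
Qed.

End limit_content.

(** * Tightness along an ultrafilter *)

Lemma sum_half_powers (R : realFieldType) (e : R) (n : nat) :
  \sum_(k < n) e / 2 ^+ k.+1 = e - e / 2 ^+ n.
Proof.
elim: n => [|n ih]; first by rewrite big_ord0 expr0 divr1 subrr.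
rewrite big_ord_recr/= ih exprS invfM mulrCA -addrA; congr (_ + _).
by rewrite [X in - X + _](splitr (e / 2 ^+ n)); lra.
Qed.

Lemma exists_half_power_le (R : realType) (e e' : R) : 0 < e -> 0 < e' ->
  exists n, e / 2 ^+ n.+1 <= e'.
Proof.
move=> e0 e'0; exists (Num.bound (e / e')).
rewrite ler_pdivrMr ?exprn_gt0// mulrC -ler_pdivrMr//.
apply: le_trans (ltW (archi_boundP _)) _; first by rewrite divr_ge0// ltW.
by rewrite -natrX ler_nat ltnW// ltnW// ltn_expl.
Qed.

Lemma metric_ball_open (R : realType) (X : metricType R) (x : X) (r : R) :
  open (ball x r).
Proof.
rewrite openE => y; rewrite ballEmdist/= => xy.
apply/nbhs_ballP; exists (r - mdist x y); first by rewrite /= subr_gt0.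
move=> z; rewrite ballEmdist/= ltrBrDl; apply: le_lt_trans.
exact: metric_triangle.
Qed.

Lemma cvg_initial_topology (S : choiceType) (T : topologicalType) (f : S -> T)
    (F : set_system S) (s : S) : Filter F ->
  F --> (s : initial_topology f) <-> f @ F --> f s.
Proof.
move=> FF; split=> [Fs A /initial_continuous|Ffs]; first exact: Fs.
move=> A /= [_ [[B Bop <-] Bfs sBfA]].
rewrite nbhs_filterE; apply: filterS sBfA _; apply: Ffs.
exact: open_nbhs_nbhs.
Qed.

Lemma Rintegral_indic d (T : measurableType d) (R : realType)
    (m : {measure set T -> \bar R}) (A : set T) : measurable A ->
  \int[m]_(x in setT) (\1_A x) = fine (m A).
Proof. by move=> mA; rewrite /Rintegral integral_indic// setIT. Qed.

Section tightness.
Variables (R : realType) (X : completeMetricType R) (omega : set_system nat).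
Variables (nu : nat -> fin_borel_measure R X) (M : R).
Hypotheses (omegaU : UltraFilter omega).
Hypothesis nu_le : forall i, (nu i setT <= M%:E)%E.

(** Condition i) for measures of uniformly bounded mass, with a real-valued limit. *)
Definition tight_along := forall eps : R, 0 < eps ->
  exists T : set (borelType X), [/\ measurable T,
    eps_totally_bounded eps (T : set X) &
    limit_content omega nu (~` T) <= eps].

(** Choose [T k] with complement of limit content at most [e / 2 ^ k.+1]. By the intersection
    theorem some [C n] misses the intersection of the first [n] sets [T k], so their complements
    cover it; the bounds add up to [e - e / 2 ^ n]. *)
Lemma tight_along_closed_cvg0 (C : nat -> set X) (e : R) :
  (forall n, omega <> principal_filter n) -> tight_along ->
  (forall n, closed (C n)) -> (forall n, C n.+1 `<=` C n) ->
  \bigcap_n C n = set0 -> 0 < e ->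
  exists n, limit_content omega nu (C n) < e.
Proof.
move=> omegaP tight cC dC C0 e0.
have ek k : 0 < e / 2 ^+ k.+1 by rewrite divr_gt0// exprn_gt0.
have /choice[T] := fun k => tight _ (ek k).
move=> /all_and3[mT tbT Te].
have [n CT] : exists n, ~ ((C n `&` \bigcap_(k < n) T k) !=set0).
  apply: contrapT => /forallNP nCT.
  suff : (\bigcap_n C n) !=set0 by rewrite C0 => -[].
  apply: (closed_totally_bounded_inter omegaU omegaP cC dC tbT) => [e'|n].
    exact: exists_half_power_le.
  exact: contrapT (nCT n).
exists n; have mC := borel_closed (cC n).
have b_ge0 := limit_content_ge0 omegaU nu_le.
have bU := limit_contentU omegaU nu_le.
have mTC k : measurable (~` T k) by exact: measurableC.
apply: (@le_lt_trans _ _ (\sum_(k < n) e / 2 ^+ k.+1)); last first.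
  by rewrite sum_half_powers ltrBlDr ltrDl divr_gt0// exprn_gt0.
apply: (@le_trans _ _ (\sum_(k < n) limit_content omega nu (~` T k)));
  last exact: ler_sum.
apply: le_trans (additive_le_bigU b_ge0 bU n mTC).
apply: (additive_le b_ge0 bU) => //; first by apply: bigsetU_measurable => k _.
move=> x Cx; rewrite -(bigcup_mkord n (fun k => ~` T k)).
apply: contrapT => nTx; apply: CT; exists x; split=> // k kn.
by apply: contrapT => Tkx; apply: nTx; exists k.
Qed.

Lemma tight_along_cvg : (forall n, omega <> principal_filter n) ->
  tight_along ->
  exists m : fin_borel_measure R X, forall f : X -> R, Cb f ->
    integral_of f (nu i) @[i --> omega] --> integral_of f m.
Proof.
move=> omegaP tight.
have [||C cC dC C0 e e0|m [mT mU]] := @content_regularization R X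
  (limit_content omega nu).
- exact: limit_content_ge0 nu_le.
- exact: limit_contentU nu_le.
- exact: tight_along_closed_cvg0.
- exists m => f; exact: cvg_integral_of_limit_content nu_le m mT mU f.
Qed.

Lemma cvg_tight_along (m : fin_borel_measure R X) : separable X ->
  (forall f : X -> R, Cb f ->
    integral_of f (nu i) @[i --> omega] --> integral_of f m) ->
  tight_along.
Proof.
(* The dense set is either empty, which is excluded since [X] has a point, or enumerated by [s]. *)
move=> [D /pfcard_geP[D0|[s]] dD] num eps eps0.
  by have [//|x []] := dD setT _ openT; [exists point|rewrite D0].
have eps2 : 0 < eps / 2 by rewrite divr_gt0.
pose G n : set X := \bigcup_(k < n) ball (s k) (eps / 2).
have mG n : measurable (G n : set (borelType X)).
  by apply: borel_open; apply: bigcup_open => k _; exact: metric_ball_open.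
have [n Gn] : exists n, (m (~` G n) < eps%:E)%E.
  have Gcvg : m \o (fun n => ~` G n) @ \oo --> m (\bigcap_n ~` G n).
    apply: nonincreasing_cvg_mu.
    - by rewrite (le_lt_trans (le_measure m _ _ (@subsetT _ _))) ?inE//;
        [exact: measurableC|exact: fin_num_fun_lty].
    - by move=> i; exact: measurableC.
    - by apply: bigcapT_measurable => i; exact: measurableC.
    - move=> i j ij; apply/subsetPset; apply: subsetC => x [k ki skx].
      by exists k => //; exact: leq_trans ij.
  (* By density every point is within [eps / 2] of some [s k], hence lies in [G k.+1]. *)
  have G0 : \bigcap_n ~` G n = set0.
    rewrite -subset0 => y Gy.
    have [z [yz Dz]] : (ball y (eps / 2) `&` D) !=set0.
      apply: dD; last exact: metric_ball_open.
      by exists y; exact: ballxx.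
    have [k _ skz] := @surj _ _ _ _ s z Dz.
    apply: (Gy k.+1) => //; exists k => //=.
    by rewrite skz; exact: ball_sym.
  move: Gcvg; rewrite G0 measure0 => /(_ _ (open_ereal_lt' _)).
  case/(_ eps%:E) => [|n _ /(_ n (leqnn n))]; first by rewrite lte_fin.
  by exists n.
pose T : set X := \bigcup_(k < n) ball (s k) eps.
have mT : measurable (T : set (borelType X)).
  by apply: borel_open; apply: bigcup_open => k _; exact: metric_ball_open.
exists T; split=> //.
  exists (s @` `I_n); first exact/finite_image/finite_II.
  by move=> x [k kn skx]; exists (s k) => //; exists k.
(* By the triangle inequality, no point of [G n] is within [eps / 2] of a point outside [T]. So a
   continuous [f] with values in [[0, 1]] vanishes on [G n] and is [1] off [T]. *)
have /(@uniform_separatorP _ R)[f [cf f01 f0 f1]] :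
    uniform_separator (G n) (~` T).
  apply: uniform_separatorW; exists [set xy | ball xy.1 (eps / 2) xy.2].
    exact: entourage_ball (PosNum eps2).
  rewrite -subset0 => -[y z] [[/= [k kn sky] Tz] yz]; apply: Tz; exists k => //.
  by rewrite [eps]splitr; exact: ball_triangle sky yz.
have f_ge0 x : 0 <= f x.
  by have /(_ (f x)) := f01; rewrite /= in_itv/= => /(_ (imageT _ _))/andP[].
have f_le1 x : f x <= 1.
  by have /(_ (f x)) := f01; rewrite /= in_itv/= => /(_ (imageT _ _))/andP[].
have fB x : `|f x| <= 1 by rewrite ger0_norm.
have intf (p : fin_borel_measure R X) :
    p.-integrable setT (EFin \o (f : borelType X -> R)).
  exact: integrable_bounded (continuous_borel_measurable cf) fB.
(* The indicator of the complement of [T] is below [f], which is below that of the complement of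
   [G n]: the first bound is integrated against [nu i], the second against [m]. *)
apply: (@le_trans _ _ (integral_of f m)).
  apply: (@ler_cvg_to _ omega _ _ (fun i => fine (nu i (~` T)))
    (fun i => integral_of f (nu i))).
  - by apply: cvg_limit_content nu_le _ _; exact: measurableC.
  - by apply: num; split=> //; apply/bounded_fun_exP; exists 1.
  - apply: nearW => i; rewrite -Rintegral_indic; last exact: measurableC.
    apply: le_Rintegral => //; [|exact: intf|].
      by apply: integrable_indic; exact: measurableC.
    move=> x _; rewrite indicE; case: (boolP (x \in ~` T)) => //.
    by rewrite inE => Tx; rewrite (f1 (f x))//; exists x.
apply: (@le_trans _ _ (fine (m (~` G n)))).
  rewrite -Rintegral_indic; last exact: measurableC.
  apply: le_Rintegral => //; [exact: intf| |].
    by apply: integrable_indic; exact: measurableC.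
  move=> x _; rewrite indicE; case: (boolP (x \in ~` G n)) => //.
  rewrite notin_setE => /contrapT Gx; rewrite (f0 (f x))//; exists x => //.
rewrite -lee_fin fineK ?ltW// fin_num_measure//; exact: measurableC.
Qed.

End tightness.

(** * Reduction to uniformly bounded masses *)

Section truncation.
Variables (R : realType) (X : ptopologicalType).
Variable mu : nat -> {measure set (borelType X) -> \bar R}.
Variable M : R.
Hypothesis M_ge0 : 0 <= M.

(* Discards the indices, negligible for omega, of measures with large or
   infinite mass. *)
Definition truncated (i : nat) : fin_borel_measure R X :=
  if pselect (mu i setT <= M%:E)%E is left mu_le
  then to_finite (le_lt_trans mu_le (ltry M))
  else (mzero : {finite_measure set (borelType X) -> \bar R}).

Lemma truncated_le i : (truncated i setT <= M%:E)%E.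
Proof. by rewrite /truncated; case: pselect => //= _; rewrite lee_fin. Qed.

Lemma truncatedE i (A : set (borelType X)) : (mu i setT <= M%:E)%E ->
  truncated i A = mu i A.
Proof. by rewrite /truncated; case: pselect. Qed.

Variable omega : set_system nat.
Hypothesis omegaF : ProperFilter omega.
Hypothesis mu_le : \forall i \near omega, (mu i setT <= M%:E)%E.

(** Truncation changes nothing for [omega]-almost all indices, and convergence in a supremum of
    initial topologies is convergence of each defining map. *)
Lemma weak_ultralimitP (m : fin_borel_measure R X) :
  weak_ultralimit omega mu (m : weak_measures R X) <->
  forall f : X -> R, Cb f ->
    integral_of f (truncated i) @[i --> omega] --> integral_of f m.
Proof.
have to_truncated (U : set (weak_measures R X)) i : (mu i setT <= M%:E)%E ->
    (exists mui_fin : (mu i setT < +oo)%E, U (to_finite mui_fin)) <->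
    U (truncated i).
  move=> mui_le; rewrite /truncated; case: pselect => //= le; split.
    (* The finite measure does not depend on the chosen proof of finiteness. *)
    by move=> [lt]; rewrite (bool_irrelevance lt (le_lt_trans le (ltry M))).
  by exists (le_lt_trans le (ltry M)).
transitivity (truncated @ omega --> (m : weak_measures R X)).
  split=> lim_m U /lim_m; apply: filterS2 mu_le => i mui_le;
    by case: (to_truncated U i mui_le).
rewrite cvg_sup; split=> [lim_m f Cf|lim_m f].
  have := lim_m (SigSub (mem_set Cf)).
  by move/cvg_initial_topology; exact.
apply/cvg_initial_topology; apply: lim_m; exact: set_valP.
Qed.

Lemma cvg_measureP (A : set (borelType X)) (l : \bar R) :
  mu i A @[i --> omega] --> l <-> truncated i A @[i --> omega] --> l.
Proof.
have muE : \forall i \near omega, mu i A = truncated i A.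
  by apply: filterS mu_le => i /truncatedE ->.
split; apply: cvg_trans; apply: near_eq_cvg => //.
by apply: filterS muE => i ->.
Qed.

End truncation.

Theorem theoremA5 (R : realType) (X : completeMetricType R)
  (omega : set_system nat)
  (mu : nat -> {measure set (borelType X) -> \bar R}) (lambda : \bar R) :
  UltraFilter omega ->
  (forall n : nat, omega <> principal_filter n) ->
  separable X ->
  mu i [set: borelType X] @[i --> omega] --> lambda ->
  (lambda < +oo)%E ->
  (forall eps : R, 0 < eps ->
     exists T : set (borelType X),
       [/\ measurable T,
           eps_totally_bounded eps (T : set X) &
           exists2 l : \bar R,
             mu i (~` T) @[i --> omega] --> l & (l <= eps%:E)%E])
  <->
  (exists m : weak_measures R X, weak_ultralimit omega mu m).
Proof.
move=> omegaU omegaP sepX mu_lambda lambda_lt.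
(* The bound is strict so that mass below [M] is an open condition around [lambda]. The type of
   [lambda] also allows [-oo], where [M = 0] serves. *)
have [M M0 lambdaM] : exists2 M : R, 0 <= M & (lambda < M%:E)%E.
  case: lambda lambda_lt {mu_lambda} => [r _|//|_].
    exists (`|r| + 1); first by rewrite addr_ge0.
    by rewrite lte_fin (le_lt_trans (ler_norm r))// ltrDl.
  by exists 0; rewrite ?ltNyr.
have muM : \forall i \near omega, (mu i setT <= M%:E)%E.
  have : \forall i \near omega, (mu i setT < M%:E)%E.
    exact: mu_lambda _ (open_ereal_lt' lambdaM).
  by apply: filterS => i /ltW.
pose nu := truncated mu M.
have nu_le := truncated_le mu M0 : forall i, (nu i setT <= M%:E)%E.
(* Truncation preserves limits along [omega], and by uniqueness the extended real limit [l] is the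
   limit content of the complement of [T]. *)
have tightP : (forall eps : R, 0 < eps -> exists T : set (borelType X),
       [/\ measurable T, eps_totally_bounded eps (T : set X) &
           exists2 l : \bar R,
             mu i (~` T) @[i --> omega] --> l & (l <= eps%:E)%E])
  <-> tight_along omega nu.
  have cvg_nu (T : set (borelType X)) : measurable T ->
      nu i (~` T) @[i --> omega] --> (limit_content omega nu (~` T))%:E.
    move=> mT; have mTC : measurable (~` T) by exact: measurableC.
    apply/fine_cvgP; split; last exact: cvg_limit_content nu_le _ mTC.
    by apply: nearW => i; exact: fin_num_measure.
  split=> tight eps /tight[T [mT tbT]].
    move=> [l /(cvg_measureP _ muM) mul le]; exists T; split=> //.
    rewrite -lee_fin; suff -> : (limit_content omega nu (~` T))%:E = l by [].
    exact: cvg_unique (cvg_nu T mT) mul.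
  move=> le; exists T; split=> //.
  exists (limit_content omega nu (~` T))%:E => //.
  by apply/(cvg_measureP _ muM); exact: cvg_nu.
rewrite tightP; split=> [tight|[m /(weak_ultralimitP _ muM)]].
  have [m num] := tight_along_cvg omegaU nu_le omegaP tight.
  by exists m; apply/(weak_ultralimitP _ muM).
exact: cvg_tight_along nu_le m sepX.
Qed.
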